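(* Let $(\mathscr{C}, \prec)$ be an ordered partition of $\mathbb{Z}_{>0}.$ For each $C \in \mathscr{C},$ choose a shuffle character $f_C \colon \mathrm{Comp}_{>0} \to \mathbbm{k}.$ Then the map $f \colon \mathrm{Comp}_{>0} \to \mathbbm{k}$ defined by \[ f(\alpha) = \begin{cases} \prod_{C \in \mathscr{C}} f_C\left(\alpha|_C\right) & \text{if } \alpha \text{ respects } (\mathscr{C}, \prec), \\ 0 & \text{otherwise} \end{cases} \] (and $f(\emptyset) = 1$) is a shuffle character.
   Context: Work over a field $\mathbbm{k}$ of characteristic zero. $\mathrm{Comp}_{>0}$ is the set of nonempty compositions (finite sequences of positive integers). For compositions $\alpha,\beta$, $\alpha \sqcup\!\sqcup \beta$ is the multiset of all compositions of length $\ell(\alpha)+\ell(\beta)$ containing $\alpha,\beta$ as disjoint subsequences, with multiplicity. A shuffle character is a map $f\colon\mathrm{Comp}_{>0}\to\mathbbm{k}$ such that, with $f(\emptyset)=1$, $f(\alpha)f(\beta)=\sum_{\gamma\in\alpha \sqcup\!\sqcup \beta}f(\gamma)$ for all compositions $\alpha,\beta$. An ordered partition of $\mathbb{Z}_{>0}$ is a pair $(\mathscr{C},\prec)$ with $\mathscr{C}$ a set partition of $\mathbb{Z}_{>0}$ and $\prec$ a total order on its blocks. A composition $\alpha=(\alpha_1,\dots,\alpha_\ell)$ respects $(\mathscr{C},\prec)$ if $C_1\preceq\dots\preceq C_\ell$ where $C_i$ is the block containing $\alpha_i$. For $C\subseteq\mathbb{Z}_{>0}$, $\alpha|_C$ is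 the subsequence of parts of $\alpha$ lying in $C$ (or $\emptyset$ if none). *)

(* Defs.v *)
From mathcomp Require Import all_boot all_algebra.
From mathcomp Require Import all_classical.

Set Implicit Arguments.
Unset Strict Implicit.
Unset Printing Implicit Defensive.

Import GRing.Theory.

Local Open Scope classical_set_scope.
Local Open Scope ring_scope.

Definition posint := {n : nat | (0 < n)%N}.

Definition composition := seq posint.

Definition nonempty_composition := {alpha : composition | alpha != [::]}.

(* The word with the letters of [alpha], in order, at the positions where the
   mask [m] is true, and those of [beta], in order, where it is false. *)
Fixpoint weave (T : Type) (m : bitseq) (alpha beta : seq T) : seq T :=
  match m, alpha, beta with
  | true :: m', x :: alpha', _ => x :: weave m' alpha' beta
  | false :: m', _, y :: beta' => y :: weave m' alpha beta'
  | _, _, _ => [::]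
  end.

(* The multiset of shuffles, as a list with repetitions: one entry for each
   choice of the positions occupied by [alpha] in a word of length
   [size alpha + size beta] (see [count_shuffle]). *)
Definition shuffle (T : eqType) (alpha beta : seq T) : seq (seq T) :=
  [seq weave (val m) alpha beta
     | m : (size alpha + size beta).-tuple bool
       in [pred m | count id (val m) == size alpha]].

Lemma weave_mask (T : eqType) (m : bitseq) (gamma : seq T) :
  size m = size gamma ->
  weave m (mask m gamma) (mask (map negb m) gamma) = gamma.
Proof. by elim: m gamma => [|[] m IH] [|x g] //= [/IH ->]. Qed.

Lemma weaveP (T : eqType) (m : bitseq) (alpha beta : seq T) :
  count id m = size alpha -> count negb m = size beta ->
  [/\ size (weave m alpha beta) = size m,
      mask m (weave m alpha beta) = alpha &
      mask (map negb m) (weave m alpha beta) = beta].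
Proof.
elim: m alpha beta => [|[] m IH] [|x a] [|y b] //=; rewrite ?add0n ?add1n //.
- by move=> [ha] hb; have [-> -> ->] := IH a [::] ha hb.
- by move=> [ha] hb; have [-> -> ->] := IH a (y :: b) ha hb.
- by move=> ha [hb]; have [-> -> ->] := IH [::] b ha hb.
- by move=> ha [hb]; have [-> -> ->] := IH (x :: a) b ha hb.
Qed.

(* The multiplicity of [gamma] is the number of ways of splitting its positions
   into an occurrence of [alpha] and a complementary occurrence of [beta]. *)
Lemma count_shuffle (T : eqType) (alpha beta gamma : seq T) :
  count_mem gamma (shuffle alpha beta) =
  #|[pred m : (size gamma).-tuple bool
      | (mask m gamma == alpha) && (mask (map negb m) gamma == beta)]|.
Proof.
have cnt m : (count id m + count negb m)%N = size m by exact: count_predC.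
rewrite /shuffle /image_mem count_map -size_filter.
rewrite -(card_uniqP (filter_uniq _ (enum_uniq _))).
have [n En] : exists n, n = (size alpha + size beta)%N by eexists.
have [p Ep] : exists p, p = size gamma by eexists.
rewrite -Ep -En; case: (eqVneq p n) => [pn|pn].
  move: pn Ep => -> Ep; apply: eq_card => m; rewrite mem_filter mem_enum !inE.
  apply/andP/andP=> [[/eqP /= <- /eqP ha]|[/eqP ha /eqP hb]].
    have hb : count negb m = size beta.
      by apply/eqP; rewrite -(eqn_add2l (size alpha)) -{1}ha cnt size_tuple En.
    by have /= [_ -> ->] := weaveP ha hb.
  have sm : size m = size gamma by rewrite size_tuple.
  by rewrite /= -{1}ha -{1}hb weave_mask // -ha size_mask // eqxx.
rewrite !eq_card0 // => m.
  rewrite !inE; apply/negP=> /andP[/eqP ha /eqP hb].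
  have sm : size m = size gamma by rewrite size_tuple.
  move: pn; rewrite En -ha -hb !size_mask ?size_map //.
  by rewrite count_map cnt size_tuple eqxx.
rewrite mem_filter mem_enum !inE.
apply/negP=> /andP[/eqP /= wg /eqP ha].
have hb : count negb m = size beta.
  by apply/eqP; rewrite -(eqn_add2l (size alpha)) -{1}ha cnt size_tuple En.
have [sw _ _] := weaveP ha hb.
by move: pn; rewrite Ep -wg sw size_tuple eqxx.
Qed.

(* [f] extended to all compositions by the convention [f [::] = 1]. *)
Definition extend (k : fieldType) (f : nonempty_composition -> k)
    (alpha : composition) : k :=
  if insub alpha is Some alpha' then f alpha' else 1.

Definition shuffle_character (k : fieldType) (f : nonempty_composition -> k) :=
  forall alpha beta : composition,
    extend f alpha * extend f beta =
    \sum_(gamma <- shuffle alpha beta) extend f gamma.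

Record ordered_partition := OrderedPartition {
  blocks : set (set posint);
  prec : rel (set posint);
  blocks_partition : partition blocks id setT;
  prec_irreflexive : forall C, blocks C -> ~~ prec C C;
  prec_transitive : forall C D E, blocks C -> blocks D -> blocks E ->
    prec C D -> prec D E -> prec C E;
  prec_total : forall C D, blocks C -> blocks D ->
    [\/ C = D, prec C D | prec D C]
}.

Definition preceq (P : ordered_partition) (C D : set posint) : bool :=
  (C == D) || prec P C D.

Definition block_of (P : ordered_partition) (x : posint) : set posint :=
  pblock (blocks P) id x.

Definition respects (P : ordered_partition) (alpha : composition) : bool :=
  sorted (preceq P) (map (block_of P) alpha).

Definition restrict (alpha : composition) (C : set posint) : composition :=
  [seq x <- alpha | x \in C].

(* The product over the possibly infinite set of blocks is the library's
   finitely supported one: only the blocks meeting [alpha] can contribute a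
   factor other than [extend (fC C) [::] = 1]. *)
Definition block_product (k : fieldType) (P : ordered_partition)
    (fC : set posint -> nonempty_composition -> k)
    (alpha : nonempty_composition) : k :=
  if respects P (val alpha) then
    \big[*%R/1]_(C \in blocks P) extend (fC C) (restrict (val alpha) C)
  else 0.

(* Main.v *)
(* Induct on the two words, letting the functions [f_C] be arbitrary: the sum of
   [f] over the shuffles of two words that respect the ordered partition is the
   product over [C] of the sums of [f_C] over the shuffles of the restrictions
   to [C].  Split the shuffles of [x :: a] and [y :: b] by first letter.  If [x]
   and [y] lie in the same block [C], this is the recursion of the shuffle in the
   factor [C], with [f_C] replaced by [f_C (x :: _)] or [f_C (y :: _)]; otherwise
   only shuffles starting with the letter of the smaller block can respect the
   order, and the other word has an empty restriction to that block.  The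
   shuffle relations of the [f_C] then turn the product of sums into a product
   of products. *)
Require Import Defs.
From mathcomp Require Import all_boot all_algebra.
From mathcomp Require Import all_classical.

Set Implicit Arguments.
Unset Strict Implicit.
Unset Printing Implicit Defensive.

Import GRing.Theory.

Local Open Scope ring_scope.

(** * Shuffles by recursion on the first letter *)

Fixpoint masks (n p : nat) : seq bitseq :=
  match n, p with
  | 0, 0 => [:: [::]]
  | 0, _.+1 => [::]
  | n'.+1, 0 => map (cons false) (masks n' 0)
  | n'.+1, p'.+1 =>
      map (cons true) (masks n' p') ++ map (cons false) (masks n' p'.+1)
  end.

Lemma mem_map_cons (T : eqType) (x : T) (s : seq (seq T)) (t : seq T) :
  (t \in map (cons x) s) =
  if t is y :: t' then (y == x) && (t' \in s) else false.
Proof.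
case: t => [|y t]; first by apply/mapP => -[].
apply/mapP/andP => [[u us [-> ->]]|[/eqP -> ts]]; first by rewrite eqxx.
by exists t.
Qed.

Lemma mem_masks (n p : nat) (m : bitseq) :
  (m \in masks n p) = (size m == n) && (count id m == p).
Proof.
elim: n p m => [|n IH] [|p] [|[] m] //=;
  by rewrite ?mem_cat ?mem_map_cons ?IH //= ?eqSS ?add1n ?add0n ?orbF ?andbF.
Qed.

Lemma masks_uniq (n p : nat) : uniq (masks n p).
Proof.
have inj x : injective (@cons bool x) by move=> ? ? [].
elim: n p => [|n IH] [|p] //=; rewrite ?cat_uniq ?map_inj_uniq ?IH //= andbT.
by apply/hasPn => _ /mapP[m _ ->]; rewrite mem_map_cons.
Qed.

Lemma masks_gt (n p : nat) : (n < p)%N -> masks n p = [::].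
Proof. by elim: n p => [|n IH] [|p] //= np; rewrite !IH // ltnW. Qed.

(** Both sides run once over each mask with [size a] true bits, so they agree up to order. The
    recursive list [masks] can then be unfolded by its first bit, unlike the enumeration of
    tuples. *)
Lemma perm_shuffle_masks (T : eqType) (a b : seq T) :
  perm_eq (shuffle a b)
    [seq weave m a b | m <- masks (size a + size b) (size a)].
Proof.
rewrite /shuffle /image_mem.
rewrite [X in perm_eq X _](map_comp (fun m => weave m a b) val).
apply/perm_map/uniq_perm.
- by rewrite map_inj_uniq ?enum_uniq //; apply: val_inj.
- exact: masks_uniq.
move=> m; rewrite mem_masks.
apply/mapP/andP => [[u]|[sm cm]].
  by rewrite mem_enum inE => cu ->; rewrite size_tuple eqxx.
by exists (Tuple sm); rewrite ?mem_enum.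
Qed.

Lemma perm_shuffle_cons (T : eqType) (x y : T) (a b : seq T) :
  perm_eq (shuffle (x :: a) (y :: b))
    (map (cons x) (shuffle a (y :: b)) ++ map (cons y) (shuffle (x :: a) b)).
Proof.
have e c (s t : seq T) := perm_map (cons c) (perm_shuffle_masks s t).
rewrite perm_sym; apply: perm_trans (perm_cat (e x a _) (e y _ b)) _.
rewrite perm_sym; apply: (perm_trans (perm_shuffle_masks _ _)).
by rewrite /= map_cat -!map_comp addnS.
Qed.

Lemma sum_shuffle_cons (R : nmodType) (T : eqType) (x y : T) (a b : seq T)
    (G : seq T -> R) :
  \sum_(g <- shuffle (x :: a) (y :: b)) G g =
  \sum_(g <- shuffle a (y :: b)) G (x :: g) +
  \sum_(g <- shuffle (x :: a) b) G (y :: g).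
Proof.
rewrite (perm_big _ (perm_shuffle_cons _ _ _ _)) big_cat.
by rewrite 2!(big_map (cons _)).
Qed.

Lemma shuffle_nil_l (T : eqType) (b : seq T) : shuffle [::] b = [:: b].
Proof.
apply: perm_small_eq => //; apply: (perm_trans (perm_shuffle_masks _ _)).
suff -> : [seq weave m [::] b | m <- masks (size b) 0] = [:: b] by [].
elim: b => //= y b IH.
by rewrite -map_comp -[RHS]/(map (cons y) [:: b]) -IH -map_comp.
Qed.

Lemma shuffle_nil_r (T : eqType) (a : seq T) : shuffle a [::] = [:: a].
Proof.
apply: perm_small_eq => //; apply: (perm_trans (perm_shuffle_masks _ _)).
rewrite addn0.
suff -> : [seq weave m a [::] | m <- masks (size a) (size a)] = [:: a] by [].
elim: a => //= x a IH; rewrite (masks_gt (ltnSn _)) cats0 -map_comp.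
by rewrite -[RHS]/(map (cons x) [:: a]) -IH -map_comp.
Qed.

(** Allows a condition on all letters, such as being above [x], to be taken out of a sum over
    shuffles. *)
Lemma all_shuffle (T : eqType) (p : pred T) (a b g : seq T) :
  g \in shuffle a b -> all p g = all p a && all p b.
Proof.
elim: a b g => [|x a IHa] b g; first by rewrite shuffle_nil_l inE => /eqP ->.
elim: b g => [|y b IHb] g; first by rewrite shuffle_nil_r inE andbT => /eqP ->.
rewrite (perm_mem (perm_shuffle_cons _ _ _ _)) mem_cat.
case/orP=> /mapP[h hs ->] /=; first by rewrite (IHa _ _ hs) andbA.
by rewrite (IHb _ hs) /= andbCA.
Qed.

(** * Sums over shuffles of weights that factor over blocks *)

Section WeightedShuffle.

Variables (R : comNzRingType) (T K : eqType) (kappa : T -> K) (le : rel K).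

Let r : rel T := relpre kappa le.

Hypotheses (r_total : total r) (r_trans : transitive r).
Hypothesis r_anti : forall x y, r x y -> r y x -> kappa x = kappa y.

Variable S : seq K.
Hypothesis S_uniq : uniq S.

Local Notation fiber C g := [seq x <- g | kappa x == C].

(** No normalization [F C [::] = 1] is imposed: the induction replaces [F] by [prepend x F], which
    would not preserve it. *)
Definition weight (F : K -> seq T -> R) (g : seq T) : R :=
  if sorted r g then \prod_(C <- S) F C (fiber C g) else 0.

Definition prepend (x : T) (F : K -> seq T -> R) (C : K) (g : seq T) : R :=
  F C (if kappa x == C then x :: g else g).

Lemma sorted_cons x g : sorted r (x :: g) = all (r x) g && sorted r g.
Proof. by rewrite /= path_sortedE. Qed.

Lemma weight_cons F x g :
  weight F (x :: g) = if all (r x) g then weight (prepend x F) g else 0.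
Proof. by rewrite /weight sorted_cons; case: (all _ g). Qed.

Lemma sum_shuffle_weight_cons F x a b :
  \sum_(g <- shuffle a b) weight F (x :: g) =
  if all (r x) a && all (r x) b
  then \sum_(g <- shuffle a b) weight (prepend x F) g else 0.
Proof.
under eq_big_seq => g gs do rewrite weight_cons (all_shuffle _ gs).
by case: ifP => // _; rewrite big1.
Qed.

(** In a sorted word the first letter [y] is below every letter [z]. Since [r] depends only on
    blocks, a [z] in the block of [x] would give [r y x]. *)
Lemma fiber_strict x y b : ~~ r y x -> sorted r (y :: b) ->
  fiber (kappa x) (y :: b) = [::].
Proof.
move=> nyx; rewrite sorted_cons => /andP[yb _].
apply/eqP; rewrite -size_eq0 size_filter -leqn0 leqNgt -has_count.
apply/hasPn => z zb; apply: contra nyx => /eqP zx.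
have rzz w : r w w by have := r_total w w; rewrite orbb.
suff : r y z by rewrite /r /= zx.
by move: zb; rewrite inE => /predU1P[->|/(allP yb)].
Qed.

Lemma sum_shuffle_weight F a b :
  {subset map kappa (a ++ b) <= S} ->
  \sum_(g <- shuffle a b) weight F g =
  if sorted r a && sorted r b
  then \prod_(C <- S) \sum_(g <- shuffle (fiber C a) (fiber C b)) F C g else 0.
Proof.
elim: a b F => [|x a IHa] b F.
  move=> _; rewrite shuffle_nil_l big_seq1 /weight /=.
  by under [in RHS]eq_bigr do rewrite shuffle_nil_l big_seq1.
elim: b F => [|y b IHb] F sS.
  rewrite shuffle_nil_r big_seq1 /weight andbT.
  by under [in RHS]eq_bigr do rewrite shuffle_nil_r big_seq1.
rewrite sum_shuffle_cons /=.
have xS : kappa x \in S by apply: sS; exact: mem_head.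
rewrite !sum_shuffle_weight_cons IHa; last first.
  by move=> C Cs; apply: sS; rewrite inE Cs orbT.
rewrite IHb; last first.
  move=> C Cs; apply: sS; move: Cs; rewrite /= !inE !map_cat !mem_cat /= inE.
  by case/or3P=> ->; rewrite ?orbT.
rewrite /= !(path_sortedE r_trans).
(* If [x :: a] or [y :: b] is not sorted, both sides vanish. *)
case sxa: (all (r x) a && sorted r a); last first.
  rewrite !if_same addr0; case: ifP => // /andP[ra _].
  by move: sxa; rewrite ra /= => ->.
case syb: (all (r y) b && sorted r b); last first.
  rewrite !andbF !if_same add0r; case: ifP => // /andP[_ rb].
  by move: syb; rewrite rb /= => ->; rewrite ?andbF.
move/andP: (sxa) => [xa sa]; move/andP: (syb) => [yb sb].
(* With both words sorted, transitivity reduces comparison with a whole word to comparison with its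
   first letter. *)
have allr u v c : r u v -> all (r v) c -> all (r u) c.
  by move=> uv; apply: sub_all => z; apply: r_trans.
rewrite xa sa yb sb /=.
have -> : r x y && all (r x) b = r x y.
  by case xy: (r x y) => //=; apply: allr xy yb.
have -> : r y x && all (r y) a && true = r y x.
  by case yx: (r y x) => //=; rewrite (allr _ _ _ yx xa).
case: (boolP (r x y)) => xy; case: (boolP (r y x)) => yx.
(* Same block: only the factor at [kappa x] differs between the two sums, and there they add up to
   the recursion of the shuffle. *)
- have xyE := r_anti xy yx.
  rewrite (bigD1_seq (kappa x)) // [in X in _ + X](bigD1_seq (kappa x)) //=.
  rewrite [in RHS](bigD1_seq (kappa x)) //= /prepend -xyE eqxx.
  rewrite sum_shuffle_cons mulrDl; congr (_ * _ + _ * _);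
    apply: eq_bigr => C /negbTE; rewrite eq_sym => xC;
    by under eq_bigr do rewrite xC; rewrite xC.
(* The block of [x] comes strictly first: [y :: b] has no letter in it, so in that factor the only
   shuffle is the fiber of [x :: a]. *)
- rewrite addr0; apply: eq_bigr => C _; rewrite /prepend.
  case: (kappa x =P C) => // <-.
  have /= -> : fiber (kappa x) (y :: b) = [::].
    by apply: fiber_strict => //; rewrite sorted_cons yb.
  by rewrite !shuffle_nil_r !big_seq1.
- rewrite add0r; apply: eq_bigr => C _; rewrite /prepend.
  case: (kappa y =P C) => // <-.
  have /= -> : fiber (kappa y) (x :: a) = [::].
    by apply: fiber_strict => //; rewrite sorted_cons xa.
  by rewrite !shuffle_nil_l !big_seq1.
- by have := r_total x y; rewrite (negbTE xy) (negbTE yx).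
Qed.
End WeightedShuffle.

(** * The preorder on letters induced by an ordered partition *)

(** [pblock] is a choice with a default value; since the blocks cover everything, a block containing
    [x] exists and the choice returns one. *)
Lemma block_ofP (P : ordered_partition) (x : posint) :
  blocks P (block_of P x) /\ block_of P x x.
Proof.
have [cov _ _] := blocks_partition P.
have [C PC Cx] : cover (blocks P) id x by rewrite cov.
exact: (@getI _ [set D | blocks P D /\ D x]%classic C (conj PC Cx)).
Qed.

Lemma mem_blocks (P : ordered_partition) (C : set posint) (x : posint) :
  blocks P C -> (x \in C) = (block_of P x == C).
Proof.
move=> PC; have [Pb bx] := block_ofP P x.
have [_ triv _] := blocks_partition P.
apply/idP/eqP => [xC|<-]; last exact/mem_set.
by apply: triv => //; exists x; split=> //; apply: set_mem.
Qed.

Section BlockOrder.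

Variable P : ordered_partition.

Let r : rel posint := relpre (block_of P) (preceq P).

Lemma block_preceq_total : total r.
Proof.
move=> x y; have [[Px _] [Py _]] := (block_ofP P x, block_ofP P y).
rewrite /r /= /preceq.
by have [->|->|->] := prec_total Px Py; rewrite ?eqxx ?orbT.
Qed.

Lemma block_preceq_trans : transitive r.
Proof.
move=> y x z; rewrite /r /= /preceq.
have [[[Px _] [Py _]] [Pz _]] := (block_ofP P x, block_ofP P y, block_ofP P z).
case/orP=> [/eqP -> //|xy] /orP[/eqP <-|yz]; first by rewrite xy orbT.
by rewrite (prec_transitive Px Py Pz xy yz) orbT.
Qed.

Lemma block_preceq_anti x y : r x y -> r y x -> block_of P x = block_of P y.
Proof.
have [[Px _] [Py _]] := (block_ofP P x, block_ofP P y).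
case/orP=> [/eqP //|xy] /orP[/eqP -> //|yx].
by have := prec_irreflexive Px; rewrite (prec_transitive Px Py Px xy yx).
Qed.

End BlockOrder.

(** * The block product as a weight, and the conclusion *)

Lemma extend_nil (k : fieldType) (f : nonempty_composition -> k) :
  extend f [::] = 1.
Proof. by rewrite /extend insubF. Qed.

Lemma restrict_fiber (P : ordered_partition) (g : composition)
    (C : set posint) :
  blocks P C -> Defs.restrict g C = [seq x <- g | block_of P x == C].
Proof. by move=> PC; apply: eq_filter => x; rewrite (mem_blocks _ PC). Qed.

(** A block outside [S] meets no letter of [g] and contributes [extend (fC C) [::] = 1]. As [S] may
    be larger than the set of blocks met by [g], one [S] can serve several words. *)
Lemma extend_block_product (k : fieldType) (P : ordered_partition)
    (fC : set posint -> nonempty_composition -> k) (S : seq (set posint))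
    (g : composition) :
  uniq S -> {subset S <= blocks P} -> {subset map (block_of P) g <= S} ->
  extend (block_product P fC) g =
  weight (block_of P) (preceq P) S (fun C => extend (fC C)) g.
Proof.
move=> uS SP gS; rewrite {1}/extend; case: insubP => [u _ ug|]; last first.
  rewrite negbK => /eqP ->; rewrite /weight /= big1 // => C _.
  exact: extend_nil.
rewrite /block_product /weight /respects ug sorted_map; case: ifP => // _.
rewrite (fsbigE S) //=; first last.
- move=> C PC CS; rewrite (restrict_fiber _ PC) -[RHS](extend_nil (fC C)).
  congr (extend _ _); apply/eqP; rewrite -[_ == _]negbK -has_filter.
  apply/hasPn => x xg; apply: contra CS => /eqP <-.
  exact/gS/map_f.
- by move=> C /SP /set_mem.
rewrite big_seq_cond [in RHS]big_seq; apply: eq_big => C.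
  by case: (boolP (C \in S)) => // /SP ->.
by case/andP=> _ PC; rewrite (restrict_fiber _ (set_mem PC)).
Qed.

Theorem theorem5p7 (k : fieldType) (k_char0 : [pchar k]%R =i pred0)
    (P : ordered_partition)
    (fC : set posint -> nonempty_composition -> k)
    (fC_shuffle : forall C : set posint,
       blocks P C -> shuffle_character (fC C)) :
  shuffle_character (block_product P fC).
Proof.
(* The blocks met by [a] or [b] suffice for [a], [b] and all their shuffles, which have no other
   letters. *)
move=> a b; pose S := undup (map (block_of P) (a ++ b)).
have SP C : C \in S -> blocks P C.
  by rewrite mem_undup => /mapP[x _ ->]; have [] := block_ofP P x.
have SP' : {subset S <= blocks P} by move=> C /SP /mem_set.
have uS : uniq S := undup_uniq _.
have abS : {subset map (block_of P) (a ++ b) <= S}.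
  by move=> C; rewrite mem_undup.
have subS g : all [in a ++ b] g -> {subset map (block_of P) g <= S}.
  by move=> /allP gab _ /mapP[x /gab xab ->]; apply/abS/map_f.
have [aS bS] : all [in a ++ b] a /\ all [in a ++ b] b.
  by split; apply/allP => x xs; rewrite /= mem_cat xs ?orbT.
have E g (gS : all [in a ++ b] g) := extend_block_product fC uS SP' (subS _ gS).
rewrite !E //; under eq_big_seq => g gs do rewrite E ?(all_shuffle _ gs) ?aS //.
rewrite sum_shuffle_weight //; last 3 first.
- exact: block_preceq_total.
- exact: block_preceq_trans.
- exact: block_preceq_anti.
rewrite /weight; case: ifP => _; last by rewrite mul0r.
case: ifP => _; rewrite ?mulr0 // -big_split /=.
by apply: eq_big_seq => C /SP PC; apply: fC_shuffle.
Qed.
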